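(* Suppose the problem (HOP) is feasible. Then the branch-and-bound algorithm described in the context (Algorithm BB) returns a global optimal solution of the problem (HOP) when it terminates.
   Context: Data of the heated oil pipeline (HOP) problem. There are $N^S$ stations $j=1,\dots,N^S$; the pipe between stations $j$ and $j+1$ is divided into $N^P_j\ge 1$ segments $r=1,\dots,N^P_j$. The given constants are: $C_p,C_f,V_c,\rho,c,g$; efficiencies $\xi_j^{CP},\xi_j^{SP},\eta_j$; volume flows $Q_{jr}$ ($r\ge 0$); lengths $L_{jr}$; inner and outer diameters $D_{jr},d_{jr}$; heat transfer coefficients $K_{jr}$; elevation differences $\Delta Z_{jr}\in\mathbb R$; pump heads $H_j^{CP}$ and $\underline H_j^{SP}\le\overline H_j^{SP}$; pump numbers $N_j^{CP},N_j^{SP}\in\mathbb Z_{\ge0}$; temperatures $T_g^{P_{jr}},T_f^{P_{jr}}$; and the lower and upper bounds (underlined/overlined) on heads and temperatures appearing below. All constants related to price, efficiency, flow, length, diameter, head, temperature and friction are nonnegative, and those occurring in denominators, as well as $Q_{jr},D_{jr}$, are positive. Put $\alpha_{jr}=K_{jr}\pi d_{jr}/(\rho Q_{jr}c)$. $f(T,Q,D)$ is a given real-valued function (evaluated at positive temperatures $T$). The inlet head and temperature of station 1 are given: $\underline H_{in}^{S_1}=\overline H_{in}^{S_1}$, $\underline T_{in}^{S_1}=\overline T_{in}^{S_1}$. Standing assumption: for all fixed $Q>0$, $D>0$, $T\mapsto f(T,Q,D)$ is convex and strictly monotonically decreasing for $T>0$. Variables (a scheme $\Psi$): $x_j,y_j,\Delta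 H_j^{SP},\Delta T_j,H_{out}^{S_j},T_{out}^{S_j}$ ($1\le j\le N^S-1$); $H_{in}^{S_j},T_{in}^{S_j}$ ($1\le j\le N^S$); $H_{out}^{P_{jr}},T_{out}^{P_{jr}}$ ($0\le r\le N^P_j$) and $T_{ave}^{P_{jr}},F_{jr}$ ($1\le r\le N^P_j$), for $1\le j\le N^S-1$. Write $z=(x,y)$. Constraints (for $j=1,\dots,N^S-1$ and $r=1,\dots,N^P_j$ unless specified; $\underline z=(\underline x,\underline y)$, $\overline z=(\overline x,\overline y)$ are integer vectors): (a) $H_{out}^{P_{jr}}=H_{out}^{P_{j,r-1}}-F_{jr}-\Delta Z_{jr}$; (b) $F_{jr}=f(T_{ave}^{P_{jr}},Q_{jr},D_{jr})L_{jr}$; (c) $T_{out}^{P_{jr}}=T_g^{P_{jr}}+T_f^{P_{jr}}+[T_{out}^{P_{j,r-1}}-(T_g^{P_{jr}}+T_f^{P_{jr}})]e^{-\alpha_{jr}L_{jr}}$; (d) $T_{ave}^{P_{jr}}=\frac13T_{out}^{P_{j,r-1}}+\frac23T_{out}^{P_{jr}}$; (e) $H_{in}^{S_j}+x_jH_j^{CP}+\Delta H_j^{SP}\ge H_{out}^{S_j}$; (f) $y_j\underline H_j^{SP}\le\Delta H_j^{SP}\le y_j\overline H_j^{SP}$; (g) $T_{in}^{S_j}+\Delta T_j=T_{out}^{S_j}$, $\Delta T_j\ge0$; (h) $T_{out}^{P_{j0}}=T_{out}^{S_j}$, $T_{out}^{P_{jN^P_j}}=T_{in}^{S_{j+1}}$,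 $H_{out}^{P_{j0}}=H_{out}^{S_j}$, $H_{out}^{P_{jN^P_j}}=H_{in}^{S_{j+1}}$; (i) $\underline H_{in}^{S_j}\le H_{in}^{S_j}\le\overline H_{in}^{S_j}$ and $\underline T_{in}^{S_j}\le T_{in}^{S_j}\le\overline T_{in}^{S_j}$ for $j=1,\dots,N^S$; $\underline H_{out}^{S_j}\le H_{out}^{S_j}\le\overline H_{out}^{S_j}$ and $\underline T_{out}^{S_j}\le T_{out}^{S_j}\le\overline T_{out}^{S_j}$ for $j\le N^S-1$; $\underline H_{out}^{P_{jr}}\le H_{out}^{P_{jr}}\le\overline H_{out}^{P_{jr}}$ for $r=1,\dots,N^P_j-1$; (j) $x_j\in\{\underline x_j,\underline x_j+1,\dots,\overline x_j\}$, $y_j\in\{\underline y_j,\underline y_j+1,\dots,\overline y_j\}$; (k) $x_j\in[\underline x_j,\overline x_j]$, $y_j\in[\underline y_j,\overline y_j]$ (real); (l) $F_{jr}\ge f(T_{ave}^{P_{jr}},Q_{jr},D_{jr})L_{jr}$. Objective: $C(x,\Delta H^{SP},\Delta T)=\sum_{j=1}^{N^S-1}\big[C_p\rho Q_{j0}g\big(\frac{x_jH_j^{CP}}{\xi_j^{CP}}+\frac{\Delta H_j^{SP}}{\xi_j^{SP}}\big)+C_fc\rho Q_{j0}\frac{\Delta T_j}{\eta_jV_c}\big]$. (HOP($\underline z,\overline z$)): minimize $C$ subject to (a)-(j); (HOP) is the case $\underline z=0$, $\overline z=(N^{CP},N^{SP})$. (HOPnr1($\underline z,\overline z$)): minimize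 $C$ subject to (a)-(i),(k). (HOPnr2($\underline z,\overline z$)): minimize $C$ subject to (a),(c)-(i),(k),(l). A vector $s=(z,\Delta H^{SP},\Delta T,H_{out}^S)$ determines a unique scheme satisfying all equality constraints of (HOP), resp. (HOPnr1), and $s$ is feasible if that scheme satisfies all inequality and integrality constraints. For (HOPnr2) the same holds with $s=(z,\Delta H^{SP},\Delta T,H_{out}^S,F)$. Algorithm BB (all subproblems are solved exactly; $\min\emptyset=+\infty$). 1. Set $\underline z=0$, $\overline z=(N^{CP},N^{SP})$, $LB=GLB=-\infty$, $GUB=+\infty$, $\mathcal Q=\{(\underline z,\overline z,LB)\}$. 2. While $\mathcal Q\ne\emptyset$ and $GLB<GUB$: (i) Choose $q=(\underline z,\overline z,LB)\in\mathcal Q$ and remove it from $\mathcal Q$. (ii) Preprocess (HOPnr1($\underline z,\overline z$)): either it is reported infeasible (correctly), or the bounds on heads and temperatures are tightened for this node without changing the feasible region of (HOPnr1($\underline z,\overline z$)), so that for each $j\le N^S-1$ there is a feasible solution of (HOPnr1($\underline z,\overline z$)) whose $T_{out}^{S_j}$ equals the tightened bound $\overline T_{out}^{S_j}$. (iii) If $LB<GUB$ and (HOPnr1($\underline z,\overline z$)) is feasible: solve (HOPnr2($\underline z,\overline z$)) (with tightened bounds) to get a (local, hence global) minimizer $\check s=(\check z,\Delta\check H^{SP},\Delta\check T,\check H^S_{out},\check F)$ and set $LB=C(\check x,\Delta\check H^{SP},\Delta\check T)$; obtain a feasible solution $\hat s$ of (HOPnr1($\underline z,\overline z$)) with the same components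 $z,\Delta H^{SP},\Delta T$ as $\check s$; obtain from $\hat s$ a feasible solution $\tilde s$ of (HOP) by $\tilde x=\lceil\hat x\rceil$, $\tilde y=\lceil\hat y\rceil$, $\Delta\tilde T=\Delta\hat T$, $\tilde H_{out}^S=\hat H_{out}^S$, and $\Delta\tilde H_j^{SP}=\Delta\hat H_j^{SP}$ if $\tilde y_j\underline H_j^{SP}\le\Delta\hat H_j^{SP}\le\tilde y_j\overline H_j^{SP}$, $\Delta\tilde H_j^{SP}=\tilde y_j\underline H_j^{SP}$ otherwise. If $C(\tilde x,\Delta\tilde H^{SP},\Delta\tilde T)<GUB$, set $GUB$ to this value and $s^*=\tilde s$. If some $\check x_{j_0}\notin\mathbb Z$ (or $\check y_{j_0}\notin\mathbb Z$), let $Lz$ be $\overline z$ with entry $x_{j_0}$ (resp. $y_{j_0}$) replaced by $\lfloor\check x_{j_0}\rfloor$ (resp. $\lfloor\check y_{j_0}\rfloor$), let $Rz$ be $\underline z$ with that entry replaced by $\lceil\check x_{j_0}\rceil$ (resp. $\lceil\check y_{j_0}\rceil$), and add $(\underline z,Lz,LB)$ and $(Rz,\overline z,LB)$ to $\mathcal Q$. (iv) Set $GLB$ to the minimum of the values $LB$ over all elements of $\mathcal Q$. 3. If $GUB=+\infty$, return ''(HOP) is infeasible''; otherwise return $s^*$ and $GUB$. *)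

(* Defs.v *)
From HB Require Import structures.
From mathcomp Require Import all_boot all_order all_algebra.
From mathcomp Require Import all_classical all_reals all_analysis.

Set Implicit Arguments.
Unset Strict Implicit.
Unset Printing Implicit Defensive.

Import Order.TTheory GRing.Theory Num.Theory.

Local Open Scope classical_set_scope.
Local Open Scope ring_scope.

(* Indexing conventions.  Stations are numbered from 1 and the segments of a
   pipe from 1, with r = 0 denoting the outlet of the station; families are
   functions on nat, and only their values at the indices quantified over
   below carry any meaning. *)

Record bounds (R : realType) := Bounds {
  HinLo : nat -> R;  HinHi : nat -> R;
  TinLo : nat -> R;  TinHi : nat -> R;
  HoutLo : nat -> R; HoutHi : nat -> R;
  ToutLo : nat -> R; ToutHi : nat -> R;
  HPLo : nat -> nat -> R; HPHi : nat -> nat -> R }.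

Record hop_data (R : realType) := HopData {
  NS : nat;
  NP : nat -> nat;
  Cp : R; Cf : R; Vc : R; rho : R;
  cspec : R;                             (* specific heat c *)
  grav : R;
  xiCP : nat -> R; xiSP : nat -> R; eta : nat -> R;
  Q : nat -> nat -> R;
  L : nat -> nat -> R;
  Din : nat -> nat -> R;                 (* inner diameter D *)
  dout : nat -> nat -> R;                (* outer diameter d *)
  K : nat -> nat -> R;
  dZ : nat -> nat -> R;
  HCP : nat -> R;
  HSPlo : nat -> R; HSPhi : nat -> R;
  NCP : nat -> nat; NSP : nat -> nat;
  Tg : nat -> nat -> R; Tf : nat -> nat -> R;
  fric : R -> R -> R -> R;               (* f(T, Q, D) *)
  bnds : bounds R }.

Definition alpha {R : realType} (d : hop_data R) (j r : nat) : R :=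
  K d j r * pi * dout d j r / (rho d * Q d j r * cspec d).

Record bounds_nonneg {R : realType} (d : hop_data R) (b : bounds R) : Prop := {
  in_nonneg : forall j, (1 <= j <= NS d)%N ->
    [/\ 0 <= HinLo b j, 0 <= HinHi b j, 0 <= TinLo b j & 0 <= TinHi b j];
  out_nonneg : forall j, (1 <= j < NS d)%N ->
    [/\ 0 <= HoutLo b j, 0 <= HoutHi b j, 0 <= ToutLo b j & 0 <= ToutHi b j];
  pipe_nonneg : forall j r, (1 <= j < NS d)%N -> (1 <= r < NP d j)%N ->
    0 <= HPLo b j r /\ 0 <= HPHi b j r }.

Record hop_data_ok {R : realType} (d : hop_data R) : Prop := {
  NS_gt0 : (0 < NS d)%N;
  NP_gt0 : forall j, (1 <= j < NS d)%N -> (1 <= NP d j)%N;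
  price_ok : 0 <= Cp d /\ 0 <= Cf d;
  physics_ok : [/\ 0 < Vc d, 0 < rho d, 0 < cspec d & 0 <= grav d];
  efficiency_ok : forall j, (1 <= j < NS d)%N ->
    [/\ 0 < xiCP d j, 0 < xiSP d j & 0 < eta d j];
  flow_ok : forall j r, (1 <= j < NS d)%N -> (r <= NP d j)%N -> 0 < Q d j r;
  pipe_ok : forall j r, (1 <= j < NS d)%N -> (1 <= r <= NP d j)%N ->
    [/\ 0 <= L d j r, 0 < Din d j r, 0 <= dout d j r & 0 <= K d j r];
  ambient_ok : forall j r, (1 <= j < NS d)%N -> (1 <= r <= NP d j)%N ->
    0 <= Tg d j r /\ 0 <= Tf d j r;
  pump_ok : forall j, (1 <= j < NS d)%N ->
    0 <= HCP d j /\ 0 <= HSPlo d j <= HSPhi d j;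
  bnds_ok : bounds_nonneg d (bnds d);
  inlet_ok : HinLo (bnds d) 1 = HinHi (bnds d) 1 /\
             TinLo (bnds d) 1 = TinHi (bnds d) 1 }.

(* f is a total function, about which nothing is assumed at nonpositive
   temperatures. *)
Definition friction_ok {R : realType} (f : R -> R -> R -> R) : Prop :=
  forall q D : R, 0 < q -> 0 < D ->
    convex_function ([set T | 0 < T] : set R^o) (fun T : R^o => f T q D) /\
    (forall T1 T2 : R, 0 < T1 -> T1 < T2 -> f T2 q D < f T1 q D).

Record zvec := ZVec { zx : nat -> int; zy : nat -> int }.

Record scheme (R : realType) := Scheme {
  px : nat -> R; py : nat -> R; pdH : nat -> R; pdT : nat -> R;
  HinS : nat -> R; TinS : nat -> R;
  HoutS : nat -> R; ToutS : nat -> R;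
  HoutP : nat -> nat -> R; ToutP : nat -> nat -> R;
  TaveP : nat -> nat -> R; FP : nat -> nat -> R }.

Definition head_balance {R : realType} (d : hop_data R) (p : scheme R) :=
  forall j r, (1 <= j < NS d)%N -> (1 <= r <= NP d j)%N ->
    HoutP p j r = HoutP p j r.-1 - FP p j r - dZ d j r.

Definition friction_eq {R : realType} (d : hop_data R) (p : scheme R) :=
  forall j r, (1 <= j < NS d)%N -> (1 <= r <= NP d j)%N ->
    FP p j r = fric d (TaveP p j r) (Q d j r) (Din d j r) * L d j r.

Definition friction_ge {R : realType} (d : hop_data R) (p : scheme R) :=
  forall j r, (1 <= j < NS d)%N -> (1 <= r <= NP d j)%N ->
    FP p j r >= fric d (TaveP p j r) (Q d j r) (Din d j r) * L d j r.

Definition temp_drop {R : realType} (d : hop_data R) (p : scheme R) :=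
  forall j r, (1 <= j < NS d)%N -> (1 <= r <= NP d j)%N ->
    ToutP p j r = Tg d j r + Tf d j r +
      (ToutP p j r.-1 - (Tg d j r + Tf d j r)) * expR (- alpha d j r * L d j r).

Definition temp_average {R : realType} (d : hop_data R) (p : scheme R) :=
  forall j r, (1 <= j < NS d)%N -> (1 <= r <= NP d j)%N ->
    TaveP p j r = 1 / 3 * ToutP p j r.-1 + 2 / 3 * ToutP p j r.

Definition station_head {R : realType} (d : hop_data R) (p : scheme R) :=
  forall j, (1 <= j < NS d)%N ->
    HinS p j + px p j * HCP d j + pdH p j >= HoutS p j.

Definition shifted_pump_range {R : realType} (d : hop_data R) (p : scheme R) :=
  forall j, (1 <= j < NS d)%N ->
    py p j * HSPlo d j <= pdH p j <= py p j * HSPhi d j.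

Definition station_heating {R : realType} (d : hop_data R) (p : scheme R) :=
  forall j, (1 <= j < NS d)%N ->
    TinS p j + pdT p j = ToutS p j /\ 0 <= pdT p j.

Definition pipe_ends {R : realType} (d : hop_data R) (p : scheme R) :=
  forall j, (1 <= j < NS d)%N ->
    [/\ ToutP p j 0 = ToutS p j, ToutP p j (NP d j) = TinS p j.+1,
        HoutP p j 0 = HoutS p j & HoutP p j (NP d j) = HinS p j.+1].

Record within_bounds {R : realType} (d : hop_data R) (b : bounds R)
    (p : scheme R) : Prop := {
  within_in : forall j, (1 <= j <= NS d)%N ->
    HinLo b j <= HinS p j <= HinHi b j /\ TinLo b j <= TinS p j <= TinHi b j;
  within_out : forall j, (1 <= j < NS d)%N ->
    HoutLo b j <= HoutS p j <= HoutHi b j /\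
    ToutLo b j <= ToutS p j <= ToutHi b j;
  within_pipe : forall j r, (1 <= j < NS d)%N -> (1 <= r < NP d j)%N ->
    HPLo b j r <= HoutP p j r <= HPHi b j r }.

Definition integer_pumps {R : realType} (d : hop_data R) (lo hi : zvec)
    (p : scheme R) :=
  forall j, (1 <= j < NS d)%N ->
    (exists2 k : int, zx lo j <= k <= zx hi j & px p j = k%:~R) /\
    (exists2 k : int, zy lo j <= k <= zy hi j & py p j = k%:~R).

Definition relaxed_pumps {R : realType} (d : hop_data R) (lo hi : zvec)
    (p : scheme R) :=
  forall j, (1 <= j < NS d)%N ->
    (zx lo j)%:~R <= px p j <= (zx hi j)%:~R /\
    (zy lo j)%:~R <= py p j <= (zy hi j)%:~R.

Record common_constraints {R : realType} (d : hop_data R) (b : bounds R)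
    (p : scheme R) : Prop := {
  cc_head : head_balance d p;
  cc_drop : temp_drop d p;
  cc_average : temp_average d p;
  cc_station : station_head d p;
  cc_shifted : shifted_pump_range d p;
  cc_heating : station_heating d p;
  cc_ends : pipe_ends d p;
  cc_bounds : within_bounds d b p }.

Definition HOP_constraints {R : realType} (d : hop_data R) (b : bounds R)
    (lo hi : zvec) (p : scheme R) : Prop :=
  [/\ common_constraints d b p, friction_eq d p & integer_pumps d lo hi p].

Definition nr1_constraints {R : realType} (d : hop_data R) (b : bounds R)
    (lo hi : zvec) (p : scheme R) : Prop :=
  [/\ common_constraints d b p, friction_eq d p & relaxed_pumps d lo hi p].

Definition nr2_constraints {R : realType} (d : hop_data R) (b : bounds R)
    (lo hi : zvec) (p : scheme R) : Prop :=
  [/\ common_constraints d b p, friction_ge d p & relaxed_pumps d lo hi p].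

(* The reduced vectors s = (z, dH^SP, dT, H_out^S), and, for the convex
   relaxation, s = (z, dH^SP, dT, H_out^S, F). *)
Record sol (R : realType) := Sol {
  sx : nat -> R; sy : nat -> R; sdH : nat -> R; sdT : nat -> R;
  sHout : nat -> R }.

Record sol2 (R : realType) := Sol2 {
  sol2_sol :> sol R;
  sF : nat -> nat -> R }.

Definition extends {R : realType} (d : hop_data R) (s : sol R) (p : scheme R) :=
  forall j, (1 <= j < NS d)%N ->
    [/\ px p j = sx s j, py p j = sy s j, pdH p j = sdH s j, pdT p j = sdT s j
      & HoutS p j = sHout s j].

Definition extends2 {R : realType} (d : hop_data R) (s : sol2 R)
    (p : scheme R) :=
  extends d s p /\
  forall j r, (1 <= j < NS d)%N -> (1 <= r <= NP d j)%N -> FP p j r = sF s j r.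

(* Since s and the given inlet values of station 1 determine through the
   equality constraints at most one scheme (at meaningful indices), "the scheme
   determined by s satisfies the constraints" is expressed existentially. *)
Definition HOP_box_feasible {R : realType} (d : hop_data R) (lo hi : zvec)
    (s : sol R) : Prop :=
  exists2 p, extends d s p & HOP_constraints d (bnds d) lo hi p.

Definition nr1_feasible {R : realType} (d : hop_data R) (b : bounds R)
    (lo hi : zvec) (s : sol R) : Prop :=
  exists2 p, extends d s p & nr1_constraints d b lo hi p.

Definition nr2_feasible {R : realType} (d : hop_data R) (b : bounds R)
    (lo hi : zvec) (s : sol2 R) : Prop :=
  exists2 p, extends2 d s p & nr2_constraints d b lo hi p.

Definition zero_z : zvec := ZVec (fun=> 0) (fun=> 0).

Definition pump_numbers {R : realType} (d : hop_data R) : zvec :=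
  ZVec (fun j => (NCP d j)%:Z) (fun j => (NSP d j)%:Z).

Definition HOP_feasible {R : realType} (d : hop_data R) (s : sol R) : Prop :=
  HOP_box_feasible d zero_z (pump_numbers d) s.

Definition cost {R : realType} (d : hop_data R) (s : sol R) : R :=
  \sum_(1 <= j < NS d)
    (Cp d * rho d * Q d j 0 * grav d *
       (sx s j * HCP d j / xiCP d j + sdH s j / xiSP d j) +
     Cf d * cspec d * rho d * Q d j 0 * (sdT s j / (eta d j * Vc d))).

Definition minimizer {R : realType} {A : Type} (feas : A -> Prop) (C : A -> R)
    (a : A) : Prop :=
  feas a /\ forall a', feas a' -> C a <= C a'.

Definition HOP_optimal {R : realType} (d : hop_data R) (s : sol R) : Prop :=
  minimizer (HOP_feasible d) (cost d) s.

Record bb_node (R : realType) := BBNode {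
  zlo : zvec;
  zhi : zvec;
  lb : \bar R }.

Record tighter {R : realType} (d : hop_data R) (b' b : bounds R) : Prop := {
  tighter_in : forall j, (1 <= j <= NS d)%N ->
    [/\ HinLo b j <= HinLo b' j, HinHi b' j <= HinHi b j,
        TinLo b j <= TinLo b' j & TinHi b' j <= TinHi b j];
  tighter_out : forall j, (1 <= j < NS d)%N ->
    [/\ HoutLo b j <= HoutLo b' j, HoutHi b' j <= HoutHi b j,
        ToutLo b j <= ToutLo b' j & ToutHi b' j <= ToutHi b j];
  tighter_pipe : forall j r, (1 <= j < NS d)%N -> (1 <= r < NP d j)%N ->
    HPLo b j r <= HPLo b' j r /\ HPHi b' j r <= HPHi b j r }.

(* [None] is the report "infeasible"; [Some b] returns tightened bounds [b],
   which are used for the current node only. *)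
Inductive preprocess {R : realType} (d : hop_data R) (q : bb_node R) :
    option (bounds R) -> Prop :=
| PreInfeasible :
    ~ (exists s, nr1_feasible d (bnds d) (zlo q) (zhi q) s) ->
    preprocess d q None
| PreTightened b :
    tighter d b (bnds d) ->
    (forall s, nr1_feasible d b (zlo q) (zhi q) s <->
               nr1_feasible d (bnds d) (zlo q) (zhi q) s) ->
    (forall j, (1 <= j < NS d)%N ->
       exists2 p, nr1_constraints d b (zlo q) (zhi q) p &
                  ToutS p j = ToutHi b j) ->
    preprocess d q (Some b).

Definition same_controls {R : realType} (d : hop_data R) (s s' : sol R) : Prop :=
  forall j, (1 <= j < NS d)%N ->
    [/\ sx s j = sx s' j, sy s j = sy s' j, sdH s j = sdH s' j
      & sdT s j = sdT s' j].

Definition round_up {R : realType} (d : hop_data R) (s : sol R) : sol R :=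
  let y j : R := (Num.ceil (sy s j))%:~R in
  {| sx := fun j => (Num.ceil (sx s j))%:~R;
     sy := y;
     sdH := fun j =>
       if y j * HSPlo d j <= sdH s j <= y j * HSPhi d j then sdH s j
       else y j * HSPlo d j;
     sdT := sdT s;
     sHout := sHout s |}.

Definition set_x (z : zvec) (j : nat) (k : int) : zvec :=
  ZVec [eta zx z with j |-> k] (zy z).

Definition set_y (z : zvec) (j : nat) (k : int) : zvec :=
  ZVec (zx z) [eta zy z with j |-> k].

(* The nodes created from [q] once the relaxation has minimizer [s] and
   optimal value [v]. *)
Inductive branching {R : realType} (d : hop_data R) (q : bb_node R) (s : sol R)
    (v : \bar R) : set (bb_node R) -> Prop :=
| BranchNone :
    (forall j, (1 <= j < NS d)%N ->
       sx s j \is a Num.int /\ sy s j \is a Num.int) ->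
    branching d q s v set0
| BranchX j :
    (1 <= j < NS d)%N -> sx s j \isn't a Num.int ->
    branching d q s v
      [set BBNode (zlo q) (set_x (zhi q) j (Num.floor (sx s j))) v;
           BBNode (set_x (zlo q) j (Num.ceil (sx s j))) (zhi q) v]
| BranchY j :
    (1 <= j < NS d)%N -> sy s j \isn't a Num.int ->
    branching d q s v
      [set BBNode (zlo q) (set_y (zhi q) j (Num.floor (sy s j))) v;
           BBNode (set_y (zlo q) j (Num.ceil (sy s j))) (zhi q) v].

(* [incumbent] is s^*, undefined until a feasible solution is found. *)
Record bb_state (R : realType) := BBState {
  queue : set (bb_node R);
  GLB : \bar R;
  GUB : \bar R;
  incumbent : option (sol R) }.

Definition bb_init {R : realType} (d : hop_data R) : bb_state R :=
  BBState [set BBNode zero_z (pump_numbers d) -oo%E] -oo%E +oo%E None.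

Definition bb_continue {R : realType} (st : bb_state R) : Prop :=
  queue st !=set0 /\ (GLB st < GUB st)%E.

(* Queues are finite along every run, so the infimum is a minimum, and it is
   +oo on the empty queue. *)
Definition queue_min {R : realType} (X : set (bb_node R)) : \bar R :=
  ereal_inf [set lb q | q in X].

Definition bb_solves {R : realType} (d : hop_data R) (st : bb_state R)
    (q : bb_node R) : Prop :=
  (lb q < GUB st)%E /\ exists s, nr1_feasible d (bnds d) (zlo q) (zhi q) s.

(* One iteration of the loop.  The choices left open (node, tightened bounds,
   minimizer, recovered solution, branching index) are arbitrary. *)
Inductive bb_step {R : realType} (d : hop_data R) (st : bb_state R) :
    bb_state R -> Prop :=
| StepDiscard q pre :
    bb_continue st -> queue st q -> preprocess d q pre -> ~ bb_solves d st q ->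
    bb_step d st
      (BBState (queue st `\ q) (queue_min (queue st `\ q)) (GUB st)
         (incumbent st))
| StepSolve q b (s2 : sol2 R) (s1 : sol R) new :
    bb_continue st -> queue st q -> preprocess d q (Some b) ->
    bb_solves d st q ->
    minimizer (nr2_feasible d b (zlo q) (zhi q)) (fun s : sol2 R => cost d s)
      s2 ->
    nr1_feasible d b (zlo q) (zhi q) s1 -> same_controls d s1 s2 ->
    branching d q s2 (cost d s2)%:E new ->
    let st' := round_up d s1 in
    let improved := ((cost d st')%:E < GUB st)%E in
    let queue' := queue st `\ q `|` new in
    bb_step d st
      (BBState queue' (queue_min queue')
         (if improved then (cost d st')%:E else GUB st)
         (if improved then Some st' else incumbent st)).

Inductive bb_reachable {R : realType} (d : hop_data R) : bb_state R -> Prop :=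
| ReachInit : bb_reachable d (bb_init d)
| ReachStep st st' :
    bb_reachable d st -> bb_step d st st' -> bb_reachable d st'.

(* [None] is the answer "(HOP) is infeasible"; otherwise s^* and GUB. *)
Definition bb_output {R : realType} (st : bb_state R) :
    option (sol R * \bar R) :=
  if GUB st == +oo%E then None
  else omap (fun s => (s, GUB st)) (incumbent st).

(* Main.v *)
Require Import Defs.
From mathcomp Require Import all_boot all_order all_algebra.
From mathcomp Require Import all_classical all_reals all_analysis.

(** At every moment of a run, each feasible point of (HOP) either costs at
    least GUB or lies in the box of a queued node whose bound LB does not
    exceed its cost: branching at a fractional component loses no integer
    point, and the optimal value of (HOPnr2) bounds the cost on the whole box
    from below.  If no component of the relaxed minimizer is fractional, then
    rounding changes nothing in its cost, and GUB drops to the optimal value of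
    the relaxation.  When the loop stops, the second alternative also gives
    cost >= LB >= GLB >= GUB. *)

Set Implicit Arguments.
Unset Strict Implicit.
Unset Printing Implicit Defensive.

Import Order.TTheory GRing.Theory Num.Theory.

Local Open Scope classical_set_scope.
Local Open Scope ring_scope.

Lemma tighter_common (R : realType) (d : hop_data R) (b b' : bounds R)
    (p : scheme R) :
  tighter d b b' -> common_constraints d b p -> common_constraints d b' p.
Proof.
move=> [tin tout tpipe] [c1 c2 c3 c4 c5 c6 c7 [win wout wpipe]]; split=> //.
split.
- move=> j hj; have [? ? ? ?] := tin j hj.
  have [/andP[? ?] /andP[? ?]] := win j hj.
  by split; apply/andP; split; apply: le_trans; eassumption.
- move=> j hj; have [? ? ? ?] := tout j hj.
  have [/andP[? ?] /andP[? ?]] := wout j hj.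
  by split; apply/andP; split; apply: le_trans; eassumption.
- move=> j r hj hr; have [? ?] := tpipe j r hj hr.
  have /andP[? ?] := wpipe j r hj hr.
  by apply/andP; split; apply: le_trans; eassumption.
Qed.

(** Carries a solution recovered under the tightened bounds of a node back to the original bounds,
    which are those of (HOP). *)
Lemma nr1_feasible_tighter (R : realType) (d : hop_data R) (b b' : bounds R)
    (lo hi : zvec) (s : sol R) :
  tighter d b b' -> nr1_feasible d b lo hi s -> nr1_feasible d b' lo hi s.
Proof.
move=> tb [p ext [cc fr rel]]; exists p => //.
by split=> //; exact: tighter_common tb cc.
Qed.

Lemma HOP_box_nr1_feasible (R : realType) (d : hop_data R) (lo hi : zvec)
    (s : sol R) :
  HOP_box_feasible d lo hi s -> nr1_feasible d (bnds d) lo hi s.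
Proof.
move=> [p ext [cc fr ip]]; exists p => //; split=> // j hj.
by have [[k /andP[? ?] ->] [l /andP[? ?] ->]] := ip j hj; rewrite !ler_int;
   split; apply/andP.
Qed.

(** Equality (b) implies inequality (l), so the friction values of the scheme itself serve as the
    component [F]. The underlying [sol], hence the cost, stays the same. *)
Lemma nr1_nr2_feasible (R : realType) (d : hop_data R) (b : bounds R)
    (lo hi : zvec) (s : sol R) :
  nr1_feasible d b lo hi s ->
  exists2 s2 : sol2 R, nr2_feasible d b lo hi s2 & s2 = s :> sol R.
Proof.
move=> [p ext [cc fr rel]]; exists (Sol2 s (FP p)) => //.
by exists p => //; split=> // j r hj hr; rewrite fr.
Qed.

Definition within_pumps (R : realType) (d : hop_data R) (lo hi : zvec) :=
  forall j, (1 <= j < NS d)%N ->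
    [/\ 0 <= zx lo j, zx hi j <= (NCP d j)%:Z,
        0 <= zy lo j & zy hi j <= (NSP d j)%:Z].

(** Pump variables enter only (e), (f) and the box constraints, so heads, temperatures and friction
    are kept. Rounding up never lowers the head that the pumps supply, and the ceilings stay below
    the integer upper ends of the box. *)
Lemma round_up_feasible (R : realType) (d : hop_data R) (lo hi : zvec)
    (s : sol R) :
  hop_data_ok d -> within_pumps d lo hi ->
  nr1_feasible d (bnds d) lo hi s -> HOP_feasible d (round_up d s).
Proof.
move=> d_ok pumps [p ext [cc fr rel]].
case: cc => c1 c2 c3 c4 c5 c6 c7 c8.
pose s' := round_up d s.
exists (Scheme (sx s') (sy s') (sdH s') (pdT p) (HinS p) (TinS p) (HoutS p)
  (ToutS p) (HoutP p) (ToutP p) (TaveP p) (FP p)).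
  by move=> j hj; have [_ _ _ ? ?] := ext j hj.
have ceil_ge0 (a : int) (x : R) : 0 <= a -> a%:~R <= x -> 0 <= Num.ceil x.
  move=> a0 ax; rewrite -(@ler_int R).
  by apply: le_trans (ceil_ge x); apply: le_trans ax; rewrite ler0z.
split=> //; first split=> //.
- move=> j hj /=; have [ex ey eh _ _] := ext j hj.
  have [HCP0 /andP[lo0 lohi]] := pump_ok d_ok hj.
  apply: le_trans (c4 j hj) _; rewrite ex eh.
  apply: lerD; first by rewrite lerD2l ler_wpM2r // ceil_ge.
  case: ifPn => // out; move: (c5 j hj); rewrite ey eh => /andP[_ le_hi].
  (* The upper limit grows with [y], so the range test can fail only at the lower limit, and the
     replacement then raises the head. *)
  have le_hi' : sdH s j <= (Num.ceil (sy s j))%:~R * HSPhi d j.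
    by apply: le_trans le_hi _; rewrite ler_wpM2r ?ceil_ge // (le_trans lo0).
  by move: out; rewrite le_hi' andbT -ltNge => /ltW.
- move=> j hj /=; have [_ ey _ _ _] := ext j hj.
  have [_ /andP[_ lohi]] := pump_ok d_ok hj.
  have [_ _ y0 _] := pumps j hj; have [_] := rel j hj.
  rewrite ey => /andP[ly _]; case: ifPn => // _.
  by rewrite lexx ler_wpM2l // ler0z (ceil_ge0 _ _ y0 ly).
- by case: c8.
- move=> j hj /=; have [ex ey _ _ _] := ext j hj.
  have [x0 xN y0 yN] := pumps j hj; have := rel j hj.
  rewrite ex ey => -[/andP[lx hx] /andP[ly hy]].
  split; [exists (Num.ceil (sx s j)) | exists (Num.ceil (sy s j))] => //=.
    by rewrite (ceil_ge0 _ _ x0 lx) (le_trans _ xN) // ceil_le_int.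
  by rewrite (ceil_ge0 _ _ y0 ly) (le_trans _ yN) // ceil_le_int.
Qed.

(** Ceilings fix integers, and (f) for [s1] then makes the range test in [round_up] succeed, so the
    shifted pump head is kept as well. *)
Lemma cost_round_up_int (R : realType) (d : hop_data R) (b : bounds R)
    (lo hi : zvec) (s1 s : sol R) :
  nr1_feasible d b lo hi s1 -> same_controls d s1 s ->
  (forall j, (1 <= j < NS d)%N ->
     sx s j \is a Num.int /\ sy s j \is a Num.int) ->
  cost d (round_up d s1) = cost d s.
Proof.
move=> [p ext [[_ _ _ _ c5 _ _ _] _ _]] same ints.
apply: eq_big_nat => j hj /=.
have [ex ey eh eT] := same j hj; have [ix iy] := ints j hj.
have [_ ey' eh' _ _] := ext j hj; have := c5 j hj.
by rewrite ey' eh' ex ey eh eT !ceilK // => ->.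
Qed.

(** The two tests amount to comparing [k] with [x] from either side. *)
Lemma int_floor_or_ceil (R : realType) (x : R) (k : int) :
  (k <= Num.floor x) || (Num.ceil x <= k).
Proof. by rewrite floor_ge_int ceil_le_int le_total. Qed.

(** Each child changes one bound at the branching index only; the integer value of [t] there decides
    which child retains [t]. *)
Lemma branching_cover (R : realType) (d : hop_data R) (q : bb_node R)
    (s t : sol R) (v : \bar R) (new : set (bb_node R)) :
  branching d q s v new -> HOP_box_feasible d (zlo q) (zhi q) t ->
  (forall j, (1 <= j < NS d)%N ->
     sx s j \is a Num.int /\ sy s j \is a Num.int) \/
  exists2 q', new q' & HOP_box_feasible d (zlo q') (zhi q') t /\ lb q' = v.
Proof.
move=> [? | j hj _ | j hj _] [p ext [cc fr ip]]; first by left.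
- right; have [[k /andP[k1 k2] ek] _] := ip j hj.
  case/orP: (int_floor_or_ceil (sx s j) k) => hk.
    exists (BBNode (zlo q) (set_x (zhi q) j (Num.floor (sx s j))) v);
      first by left.
    split=> //; exists p => //; split=> // i hi.
    have [hx hy] := ip i hi; split=> //=.
    by case: eqP => // ->; exists k => //; rewrite k1.
  exists (BBNode (set_x (zlo q) j (Num.ceil (sx s j))) (zhi q) v);
      first by right.
  split=> //; exists p => //; split=> // i hi.
  have [hx hy] := ip i hi; split=> //=.
  by case: eqP => // ->; exists k => //; rewrite hk.
- right; have [_ [k /andP[k1 k2] ek]] := ip j hj.
  case/orP: (int_floor_or_ceil (sy s j) k) => hk.
    exists (BBNode (zlo q) (set_y (zhi q) j (Num.floor (sy s j))) v);
      first by left.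
    split=> //; exists p => //; split=> // i hi.
    have [hx hy] := ip i hi; split=> //=.
    by case: eqP => // ->; exists k => //; rewrite k1.
  exists (BBNode (set_y (zlo q) j (Num.ceil (sy s j))) (zhi q) v);
      first by right.
  split=> //; exists p => //; split=> // i hi.
  have [hx hy] := ip i hi; split=> //=.
  by case: eqP => // ->; exists k => //; rewrite hk.
Qed.

(** The branching value lies in the box of [q], whose ends are integers: its floor is at most the
    old upper end and its ceiling at least the old lower end. *)
Lemma branching_within_pumps (R : realType) (d : hop_data R) (b : bounds R)
    (q : bb_node R) (s : sol2 R) (v : \bar R) (new : set (bb_node R)) :
  within_pumps d (zlo q) (zhi q) -> nr2_feasible d b (zlo q) (zhi q) s ->
  branching d q s v new ->
  forall q', new q' -> within_pumps d (zlo q') (zhi q').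
Proof.
move=> pumps [p [ext _] [_ _ rel]] br q' newq'.
have floorP (x : R) (m n : int) : x <= m%:~R -> m <= n -> Num.floor x <= n.
  move=> xm; apply: le_trans; rewrite -(@ler_int R).
  exact: le_trans (floor_le x) xm.
have ceilP (x : R) (m : int) : m%:~R <= x -> 0 <= m -> 0 <= Num.ceil x.
  move=> mx m0; apply: le_trans m0 _; rewrite -(@ler_int R).
  exact: le_trans mx (ceil_ge x).
case: br newq' => [? //|j hj _|j hj _] [] -> i hi /=;
  have [? ? ? ?] := pumps i hi; have [ex ey _ _ _] := ext i hi;
  have := rel i hi; rewrite ex ey => -[/andP[? ?] /andP[? ?]];
  split=> //; case: eqP => [<-|//];
  by [apply: floorP; eassumption | apply: ceilP; eassumption].
Qed.

(** [inv_nodes] ensures that rounding at any queued node gives a point of (HOP); [inv_incumbent]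
    makes a finite [GUB] an attained cost. *)
Record bb_invariant (R : realType) (d : hop_data R) (st : bb_state R) : Prop := {
  inv_nodes : forall q, queue st q -> within_pumps d (zlo q) (zhi q);
  inv_incumbent :
    if incumbent st is Some s
    then HOP_feasible d s /\ GUB st = (cost d s)%:E
    else GUB st = +oo%E;
  inv_GLB : forall q, queue st q -> (GLB st <= lb q)%E;
  inv_cover : forall s, HOP_feasible d s ->
    (GUB st <= (cost d s)%:E)%E \/
    exists2 q, queue st q &
      HOP_box_feasible d (zlo q) (zhi q) s /\ (lb q <= (cost d s)%:E)%E }.

Lemma queue_min_le (R : realType) (X : set (bb_node R)) (q : bb_node R) :
  X q -> (queue_min X <= lb q)%E.
Proof. by move=> Xq; apply: ereal_inf_lbound; exists q. Qed.

Lemma bb_init_invariant (R : realType) (d : hop_data R) :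
  bb_invariant d (bb_init d).
Proof.
split=> //=.
- by move=> q -> j hj /=.
- by move=> q _; exact: leNye.
- move=> s feas; right; eexists; first reflexivity.
  by split=> //=; exact: leNye.
Qed.

Lemma bb_step_invariant (R : realType) (d : hop_data R) (st st' : bb_state R) :
  hop_data_ok d -> bb_step d st st' -> bb_invariant d st -> bb_invariant d st'.
Proof.
move=> d_ok [q pre _ _ _ unsolved | q b s2 s1 new _ Qq prep _ min2 s1F same br
    rounded improved queue']
  [nodes inc glb cover].
  split=> //=; first by move=> q' [/nodes].
    by move=> q' Qq'; exact: queue_min_le.
  move=> s /cover[|[q' Qq' [boxs lbs]]]; first by left.
  (* If [s] lies in the discarded node and beats [GUB], then the LB test passes and [s] witnesses
     feasibility of (HOPnr1), so the node would have been solved. *)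
  have [eq|neq] := pselect (q' = q); last by right; exists q'.
  subst q'; left; rewrite leNgt; apply/negP => lt; apply: unsolved; split.
    exact: le_lt_trans lbs lt.
  by exists s; exact: HOP_box_nr1_feasible.
inversion prep as [|b' tb same_region _ eb]; subst b'.
have [s2F s2min] := min2.
split=> /=.
- move=> q' [[/nodes //]|]; exact: branching_within_pumps (nodes q Qq) s2F br q'.
- case: ifPn => // _; split=> //.
  apply: (round_up_feasible d_ok (nodes q Qq)).
  exact: nr1_feasible_tighter tb s1F.
- by move=> q' Qq'; exact: queue_min_le.
(* The updated [GUB] is the minimum of the old one and the rounded cost. *)
have GUB_le : ((if ((cost d (round_up d s1))%:E < GUB st)%E
    then (cost d (round_up d s1))%:E else GUB st)
    <= GUB st)%E by case: ifPn => // /ltW.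
have GUB_le_new : ((if ((cost d (round_up d s1))%:E < GUB st)%E
    then (cost d (round_up d s1))%:E else GUB st)
    <= (cost d (round_up d s1))%:E)%E by case: ifPn => //; rewrite -leNgt.
move=> s /cover[le|[q' Qq' [boxs lbs]]].
  by left; exact: le_trans GUB_le le.
have [eq|neq] := pselect (q' = q); last by right; exists q' => //; left; split.
subst q'.
(* Tightening preserves the (HOPnr1) region of the node, so [s] still competes in the relaxation
   that [s2] minimizes. *)
have le_s : cost d s2 <= cost d s.
  have /same_region/nr1_nr2_feasible[s' s'F <-] := HOP_box_nr1_feasible boxs.
  exact: s2min.
have [ints|[q' newq' [boxs' lbq']]] := branching_cover br boxs; last first.
  by right; exists q'; [right | split=> //; rewrite lbq' lee_fin].
left; apply: le_trans GUB_le_new _.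
by rewrite lee_fin (cost_round_up_int s1F same ints).
Qed.

Lemma bb_reachable_invariant (R : realType) (d : hop_data R) (st : bb_state R) :
  hop_data_ok d -> bb_reachable d st -> bb_invariant d st.
Proof.
move=> d_ok; elim=> [|st1 st2 _ inv step]; first exact: bb_init_invariant.
exact: bb_step_invariant step inv.
Qed.

Theorem theorem3 (R : realType) (d : hop_data R)
    (d_ok : hop_data_ok d) (f_ok : friction_ok (fric d))
    (feas : exists s : sol R, HOP_feasible d s)
    (st : bb_state R) (run : bb_reachable d st) (halted : ~ bb_continue st) :
  exists s : sol R,
    bb_output st = Some (s, (cost d s)%:E) /\ HOP_optimal d s.
Proof.
have [_ inc glb cover] := bb_reachable_invariant d_ok run.
have GUB_min s : HOP_feasible d s -> (GUB st <= (cost d s)%:E)%E.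
  move=> /cover[//|[q Qq [_ lbs]]]; rewrite leNgt; apply/negP => lt.
  apply: halted; split; first by exists q.
  exact: le_lt_trans (glb q Qq) (le_lt_trans lbs lt).
case: feas => s0 s0F; rewrite /bb_output.
(* Without an incumbent [GUB] would be +oo, against the finite cost of [s0]. *)
case: (incumbent st) inc => [s [sF GUBs]|GUBoo]; last first.
  by have := GUB_min _ s0F; rewrite GUBoo leye_eq.
exists s; rewrite GUBs; split=> //; split=> // s' /GUB_min.
by rewrite GUBs lee_fin.
Qed.
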